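(* Let $\Gamma\cup\{\theta\}$ be a finite set of MD-sentences of the form $\langle\varphi_1,\ldots,\varphi_k;S\rangle$ with each $\varphi_i$ being a sentence (no free variables) in the usual sense of a first-order predicate language with equality. Then $\Gamma\vdash\theta$ if and only if $\Gamma\vDash\theta$.
   Context: Fix a real-valued logic, i.e. a collection of connectives, each $n$-ary connective $\circ$ being interpreted by a function $\circ\colon[0,1]^n\to[0,1]$, and a first-order relational vocabulary $\tau$, with the equality symbol $\approx$ allowed. Formulas are built from atomic formulas with the connectives and the quantifiers $\forall,\exists$. Models. A model $\mathfrak M$ with non-empty domain $M$ interprets each $n$-ary predicate $R\in\tau$ by a map $R_{\mathfrak M}\colon M^n\to[0,1]$. Truth-values: $\|P[\overline a]\|_{\mathfrak M}=P_{\mathfrak M}(\overline a)$; $\|(x\approx y)[d,e]\|_{\mathfrak M}$ is $1$ if $d=e$ and $0$ if $d\neq e$; $\|\circ(\varphi_1,\ldots,\varphi_n)[\overline a]\|_{\mathfrak M}=\circ(\|\varphi_1[\overline a]\|_{\mathfrak M},\ldots,\|\varphi_n[\overline a]\|_{\mathfrak M})$; $\|(\forall x)\varphi[\overline a]\|_{\mathfrak M}=\inf\{\|\varphi[\overline a,e]\|_{\mathfrak M}\mid e\in M\}$; $\|(\exists x)\varphi[\overline a]\|_{\mathfrak M}=\sup\{\|\varphi[\overline a,e]\|_{\mathfrak M}\mid e\in M\}$. For an MD-sentence $\langle\varphi_1,\ldots,\varphi_k;S\rangle$ all of whose components are sentences (so $S\subseteq[0,1]^k$), $\mathfrak M$ satisfies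 it if the tuple of truth-values of $\varphi_1,\ldots,\varphi_k$ in $\mathfrak M$ is in $S$. $\Gamma\vDash\theta$ means that every model (with an arbitrary domain) satisfying all members of $\Gamma$ satisfies $\theta$. Legal domains. The legal domains are: $\{1,2,\ldots\}$ and, for each natural number $n\geq1$, one domain $D_n$ of size $n$, all these being pairwise disjoint. General MD-sentences (used in proofs). These are expressions $\langle\varphi_1(\overline x_{\varphi_1}),\ldots,\varphi_k(\overline x_{\varphi_k});S\rangle$, where each $\varphi_i$ is a first-order formula with free variables exactly $\overline x_{\varphi_i}=x_{i_1},\ldots,x_{i_{n_i}}$ ($n_i\ge0$) and $S\subseteq X_{n_1}\times\cdots\times X_{n_k}$, where $X_n:=[0,1]^{\bigcup_{M\text{ legal}}M^{n}}$ (for $n=0$, simply $[0,1]$). For $f\in X_n$ and $M$ legal, $f\restriction M$ denotes the restriction of $f$ to $M^n$. Good tuples. For a $j$-ary connective $\circ$ and functions $g_1,\ldots,g_j$ from Cartesian powers of $M$ to $[0,1]$ associated with formulas, $\circ(g_1,\ldots,g_j)$ is the function obtained by applying $\circ$ to the outputs of the $g_i$'s (arguments being taken componentwise, matched according to the free variables). Given $\langle\varphi_1,\ldots,\varphi_k;S\rangle$, a tuple $\langle f_1,\ldots,f_k\rangle\in S$ is good if for some legal domain $M$: (a) $f_m\restriction M=\circ(f_{m_1}\restriction M,\ldots,f_{m_j}\restriction M)$ whenever $\varphi_m=\circ(\varphi_{m_1},\ldots,\varphi_{m_j})$; (b) whenever $\varphi_i=\forall y\,\varphi_j$, $(f_i\restriction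 M)(e_1,\ldots,e_{n_i})=\inf\{(f_j\restriction M)(e_1,\ldots,e_{n_i},e)\mid e\in M\}$ for all $e_1,\ldots,e_{n_i}\in M$; (c) whenever $\varphi_i=\exists y\,\varphi_j$, $(f_i\restriction M)(e_1,\ldots,e_{n_i})=\sup\{(f_j\restriction M)(e_1,\ldots,e_{n_i},e)\mid e\in M\}$ for all $e_1,\ldots,e_{n_i}\in M$ (in (b),(c) $e$ is placed in the argument position of $y$). Proof system. Axiom (1)$^*$: $\langle\varphi_1,\ldots,\varphi_k;X_{n_1}\times\cdots\times X_{n_k}\rangle$ for all formulas $\varphi_1,\ldots,\varphi_k$. Rule (2)$^*$: from $\langle\varphi_1,\ldots,\varphi_k;S\rangle$ infer $\langle\varphi_{\pi(1)},\ldots,\varphi_{\pi(k)};S'\rangle$, where $\pi$ is a permutation of $1,\ldots,k$ and $S'=\{\langle f_{\pi(1)},\ldots,f_{\pi(k)}\rangle\mid\langle f_1,\ldots,f_k\rangle\in S\}$. Rule (3)$^*$: from $\langle\varphi_1,\ldots,\varphi_k;S\rangle$ infer $\langle\varphi_1,\ldots,\varphi_k,\varphi_{k+1},\ldots,\varphi_m;S\times X_{n_{k+1}}\times\cdots\times X_{n_m}\rangle$. Rule (4)$^*$: from $\langle\varphi_1,\ldots,\varphi_k;S_1\rangle$ and $\langle\varphi_1,\ldots,\varphi_k;S_2\rangle$ infer $\langle\varphi_1,\ldots,\varphi_k;S_1\cap S_2\rangle$. Rule (5)$^*$: for $0<r<k$, from $\langle\varphi_1,\ldots,\varphi_k;S\rangle$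 infer $\langle\varphi_1,\ldots,\varphi_{k-r};S'\rangle$, where $S'=\{\langle f_1,\ldots,f_{k-r}\rangle\mid\langle f_1,\ldots,f_k\rangle\in S\}$. Rule (6)$^*$: from $\langle\varphi_1,\ldots,\varphi_k;S\rangle$ infer $\langle\varphi_1,\ldots,\varphi_k;S'\rangle$ whenever $S\subseteq S'$. Rule (7)$^*$: from $\langle\varphi_1,\ldots,\varphi_k;S\rangle$ infer $\langle\varphi_1,\ldots,\varphi_k;S'\rangle$, where $S'$ is the set of good tuples in $S$. $\Gamma\vdash\theta$ means that there is a finite sequence of general MD-sentences ending in $\theta$, each element of which is an axiom, a member of $\Gamma$, or follows from previous elements by one of the rules.
   Formalization: In rule (7)*, ''good'' additionally requires that on M equality atoms are interpreted as identity and all atoms with the same predicate come from one function; otherwise the valid ⟨∀x(x≈x);{1}⟩ would not be derivable. *)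

(* Defs.v *)
From mathcomp Require Import all_boot all_order all_algebra.
From mathcomp Require Import fingroup perm.
From mathcomp Require Import all_classical all_reals.
From mathcomp Require Import interval_inference.

Set Implicit Arguments.
Unset Strict Implicit.
Unset Printing Implicit Defensive.

Import Order.TTheory GRing.Theory Num.Theory.

Local Open Scope classical_set_scope.
Local Open Scope ring_scope.

Section UnitInterval.
Variable R : realType.

Section InfSup.
Variables (T : Type) (F : T -> {i01 R}).
Let E : set R := [set (F t)%:num | t in setT].

(* The library inf and sup of an empty set are 0, so no inhabitant of T is
   needed here. *)
Fact inf01_subproof : (0 <= inf E) * (inf E <= 1).
Proof.
have [[t [s _ _]]|E0] := pselect (E !=set0); last first.
  by move/nonemptyPn : E0 => ->; rewrite inf0 lexx ler01.
have lbE : lbound E 0 by move=> _ [u _ <-].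
split; first by apply: lb_le_inf => //; exists (F s)%:num, s.
apply: (@le_trans _ _ (F s)%:num) => //.
by apply: ge_inf; [exists 0 | exists s].
Qed.

Fact sup01_subproof : (0 <= sup E) * (sup E <= 1).
Proof.
have [[t [s _ _]]|E0] := pselect (E !=set0); last first.
  by move/nonemptyPn : E0 => ->; rewrite sup0 lexx ler01.
have ubE : ubound E 1 by move=> _ [u _ <-].
split; last by apply: ge_sup => //; exists (F s)%:num, s.
apply: (@le_trans _ _ (F s)%:num) => //.
by apply: ub_le_sup; [exists 1 | exists s].
Qed.

Definition inf01 : {i01 R} := Itv01 inf01_subproof.1 inf01_subproof.2.
Definition sup01 : {i01 R} := Itv01 sup01_subproof.1 sup01_subproof.2.

End InfSup.

Record logic := Logic {
  conn : Type;
  conn_ar : conn -> nat;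
  conn_fun : forall c : conn, ('I_(conn_ar c) -> {i01 R}) -> {i01 R} }.

End UnitInterval.

Record vocabulary := Vocabulary { pred_sym : Type; pred_ar : pred_sym -> nat }.

Inductive formula (R : realType) (L : logic R) (tau : vocabulary) : Type :=
| Atom (P : pred_sym tau) (x : 'I_(pred_ar P) -> nat)
| Equal (x y : nat)
| Conn (c : conn L) (phi : 'I_(conn_ar c) -> formula L tau)
| Forall (y : nat) (phi : formula L tau)
| Exists (y : nat) (phi : formula L tau).

Arguments Atom {R L tau} P x.
Arguments Equal {R L tau} x y.
Arguments Conn {R L tau} c phi.
Arguments Forall {R L tau} y phi.
Arguments Exists {R L tau} y phi.

Section Syntax.
Variables (R : realType) (L : logic R) (tau : vocabulary).
Implicit Types phi : formula L tau.

Fixpoint free_occ phi : seq nat :=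
  match phi with
  | Atom P x => [seq x i | i <- enum 'I_(pred_ar P)]
  | Equal x y => [:: x; y]
  | Conn c psi => flatten [seq free_occ (psi i) | i <- enum 'I_(conn_ar c)]
  | Forall y psi | Exists y psi => [seq x <- free_occ psi | x != y]
  end.

(* The free variables, listed without repetition by increasing index; this is
   the order in which the arguments of the functions in X are taken. *)
Definition fvars phi : seq nat := sort leq (undup (free_occ phi)).

Definition nfv phi : nat := size (fvars phi).

Definition fv phi (l : 'I_(nfv phi)) : nat := tnth (in_tuple (fvars phi)) l.

Definition sentence phi : Prop := fvars phi = [::].

End Syntax.

Definition upd (T : Type) (v : nat -> T) (y : nat) (e : T) : nat -> T :=
  fun x => if x == y then e else v x.

Definition eq01 (R : realType) (T : Type) (d e : T) : {i01 R} :=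
  if `[< d = e >] then 1%:i01 else 0%:i01.

Section Models.
Variables (R : realType) (L : logic R) (tau : vocabulary).

Record model := Model {
  carrier :> Type;
  carrier_nonempty : inhabited carrier;
  interp : forall P : pred_sym tau, ('I_(pred_ar P) -> carrier) -> {i01 R} }.

Fixpoint truth (A : model) (phi : formula L tau) (v : nat -> A) : {i01 R} :=
  match phi with
  | Atom P x => interp (fun i => v (x i))
  | Equal x y => eq01 R (v x) (v y)
  | Conn c psi => @conn_fun R L c (fun i => truth (psi i) v)
  | Forall y psi => inf01 (fun e => truth psi (upd v y e))
  | Exists y psi => sup01 (fun e => truth psi (upd v y e))
  end.

End Models.

(* LegalFin n is the legal domain of size n.+1. *)
Inductive legal := LegalInf | LegalFin (n : nat).

Definition legal_dom (M : legal) : Type :=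
  match M with
  | LegalInf => {n : nat | (0 < n)%N}
  | LegalFin n => 'I_n.+1
  end.
Coercion legal_dom : legal >-> Sortclass.

Section MDSentences.
Variables (R : realType) (L : logic R) (tau : vocabulary).
Implicit Types phi psi : formula L tau.

(* For n > 0 the powers M ^ n of the distinct legal domains are disjoint, so a
   function on their union is a family indexed by M; for n = 0 they all
   coincide, and X 0 is the unit interval itself. *)
Definition X (n : nat) : Type :=
  if n is 0 then {i01 R} else forall M : legal, ('I_n -> M) -> {i01 R}.

Definition restrict (n : nat) : X n -> forall M : legal, ('I_n -> M) -> {i01 R} :=
  match n return X n -> forall M : legal, ('I_n -> M) -> {i01 R} with
  | 0 => fun a _ _ => a
  | n'.+1 => fun f => f
  end.

Definition Xconst (n : nat) (a : {i01 R}) : X n :=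
  match n return X n with
  | 0 => a
  | n'.+1 => fun _ _ => a
  end.

(* The restriction of f to M, with its arguments read off an assignment of the
   variables, which is what matches arguments of different formulas. *)
Definition at_ phi (f : X (nfv phi)) (M : legal) (v : nat -> M) : {i01 R} :=
  restrict f (fun l => v (fv l)).

Definition Xprod (k : nat) (phi : 'I_k -> formula L tau) : Type :=
  forall i : 'I_k, X (nfv (phi i)).

Record mdsent := MD {
  md_pred : nat;
  md_comp : 'I_md_pred.+1 -> formula L tau;
  md_set : set (Xprod md_comp) }.

Definition md_sentential (theta : mdsent) : Prop :=
  forall i, sentence (md_comp (m := theta) i).

(* Meant for sentential theta only: there the truth values do not depend on v,
   all factors are X 0, and Xconst is the identity. *)
Definition satisfies (A : model R tau) (theta : mdsent) : Prop :=
  forall v : nat -> A,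
    md_set (m := theta) (fun i => Xconst _ (truth (md_comp (m := theta) i) v)).

Definition entails (Gamma : set mdsent) (theta : mdsent) : Prop :=
  forall A : model R tau,
    (forall gamma, Gamma gamma -> satisfies A gamma) -> satisfies A theta.

(* The first two clauses fix the atomic components: equality is identity on M,
   and the atoms with the same predicate symbol come from one function on a
   power of M. Without them distinct occurrences of a predicate would be
   unrelated and x = x could take any value, so that, e.g.,
   (forall x, x = x; {1}) would be valid but underivable. *)
Definition good (k : nat) (phi : 'I_k -> formula L tau) (f : Xprod phi) : Prop :=
  exists (M : legal)
         (I : forall P : pred_sym tau, ('I_(pred_ar P) -> M) -> {i01 R}),
  [/\ (forall i P x, phi i = Atom P x ->
         forall v : nat -> M, at_ (f i) v = I P (fun l => v (x l))),
      (forall i x y, phi i = Equal x y ->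
         forall v : nat -> M, at_ (f i) v = eq01 R (v x) (v y)),
      (forall m c (idx : 'I_(conn_ar c) -> 'I_k),
         phi m = Conn c (fun t => phi (idx t)) ->
         forall v : nat -> M,
           at_ (f m) v = @conn_fun R L c (fun t => at_ (f (idx t)) v)),
      (forall i j y, phi i = Forall y (phi j) ->
         forall v : nat -> M,
           at_ (f i) v = inf01 (fun e => at_ (f j) (upd v y e))) &
      (forall i j y, phi i = Exists y (phi j) ->
         forall v : nat -> M,
           at_ (f i) v = sup01 (fun e => at_ (f j) (upd v y e)))].

Inductive infer (prev : set mdsent) : mdsent -> Prop :=
| Axiom1 k (phi : 'I_k.+1 -> formula L tau) :
    infer prev (MD (md_comp := phi) setT)
| Rule2 k (phi : 'I_k.+1 -> formula L tau) (S : set (Xprod phi))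
    (s : {perm 'I_k.+1}) :
    prev (MD S) ->
    infer prev (MD (md_comp := fun i => phi (s i))
                   [set (fun i => f (s i)) | f in S])
| Rule3 k m (phi : 'I_(k.+1 + m) -> formula L tau)
    (S : set (Xprod (fun i : 'I_k.+1 => phi (lshift m i)))) :
    prev (MD S) ->
    infer prev (@MD (k + m) phi [set f | S (fun i => f (lshift m i))])
| Rule4 k (phi : 'I_k.+1 -> formula L tau) (S1 S2 : set (Xprod phi)) :
    prev (MD S1) -> prev (MD S2) -> infer prev (MD (S1 `&` S2))
| Rule5 k r (phi : 'I_(k.+1 + r) -> formula L tau) (S : set (Xprod phi)) :
    (0 < r)%N -> prev (@MD (k + r) phi S) ->
    infer prev (MD (md_comp := fun i : 'I_k.+1 => phi (lshift r i))
                   [set (fun i => f (lshift r i)) | f in S])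
| Rule6 k (phi : 'I_k.+1 -> formula L tau) (S S' : set (Xprod phi)) :
    S `<=` S' -> prev (MD S) -> infer prev (MD S')
| Rule7 k (phi : 'I_k.+1 -> formula L tau) (S : set (Xprod phi)) :
    prev (MD S) -> infer prev (MD (S `&` @good k.+1 phi)).

Definition proves (Gamma : set mdsent) (theta : mdsent) : Prop :=
  exists (n : nat) (d : nat -> mdsent),
    d n = theta /\
    forall i, (i <= n)%N ->
      Gamma (d i) \/ infer [set d j | j in [set j | (j < i)%N]] (d i).

End MDSentences.

(* Main.v *)
Require Import Defs.
From mathcomp Require Import all_boot all_order all_algebra.
From mathcomp Require Import fingroup perm.
From mathcomp Require Import all_classical all_reals.
From mathcomp Require Import interval_inference.

(** The rules handle tuples of functions on powers of the legal domains, while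
    entailment quantifies over models of every cardinality; the two sides meet
    in the models whose carrier is a legal domain.

    Soundness.  Fix a model on a legal domain M.  Call an MD-sentence accepted
    by the model if its set contains every tuple of functions that restricts on
    M to the truth functions of the components, whatever it does on the other
    legal domains.  Every rule preserves acceptance ([infer_accepts]); in
    particular a tuple that agrees on M with truth functions is good, with M as
    witness, and survives the restriction to good tuples.
    For MD-sentences made of sentences, acceptance is satisfaction.  An
    arbitrary model is then reduced to a legal domain by a downward
    Loewenheim-Skolem argument ([lowenheim_skolem]), applied to the finitely
    many formulas that occur in the hypotheses and in the conclusion.  The
    submodel it yields is countable, and since equality is interpreted as
    identity its true size, finite or countably infinite, is that of a legal
    domain.

    Completeness.  List all components of the hypotheses and of the conclusion,
    with repetitions, together with all their subformulas ([joint_family]).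
    Extend every hypothesis to this list, intersect, and keep the good tuples.
    On a list closed under subformulas, goodness forces a tuple to agree on
    some legal domain with the truth functions of one model ([good_truth]); this
    model satisfies the hypotheses, hence the conclusion, so the part of the
    tuple that belongs to the conclusion lies in its set, and weakening followed
    by projection ends the derivation.  The restriction to good tuples is used
    only once. *)

Set Implicit Arguments.
Unset Strict Implicit.
Unset Printing Implicit Defensive.

Import Order.TTheory GRing.Theory Num.Theory.

Local Open Scope classical_set_scope.
Local Open Scope ring_scope.

(** * Infima and suprema over a subfamily *)

Section ExtremaOnSubfamily.
Variables (R : realType) (T U : Type) (r : T -> U) (F : U -> {i01 R}).
Hypothesis T_inh : inhabited T.

(** Rational thresholds make the condition countable, so that countably many
    witnesses can secure it. *)
Lemma inf01_subfamily :
  (forall q : rat, (exists u, (F u)%:num < ratr q) ->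
     exists t, (F (r t))%:num < ratr q) ->
  inf01 (fun t => F (r t)) = inf01 F.
Proof.
have [t0] := T_inh => appr; apply/val_inj => /=; apply/le_anti/andP; split.
  rewrite leNgt; apply/negP => /rat_in_itvoo[q]; rewrite in_itv /= => /andP[].
  move=> /inf_lt[|_ [u _ <-] Fu]; first by exists (F (r t0))%:num, (r t0).
  have [t Ft] := appr q (ex_intro _ u Fu).
  rewrite ltNge => /negP; apply; apply/ltW/(le_lt_trans _ Ft).
  by apply: ge_inf; [exists 0%R => _ [s _ <-] | exists t].
apply: lb_le_inf; first by exists (F (r t0))%:num, t0.
move=> _ [t _ <-].
by apply: ge_inf; [exists 0%R => _ [s _ <-] | exists (r t)].
Qed.

Lemma sup01_subfamily :
  (forall q : rat, (exists u, ratr q < (F u)%:num) ->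
     exists t, ratr q < (F (r t))%:num) ->
  sup01 (fun t => F (r t)) = sup01 F.
Proof.
have [t0] := T_inh => appr; apply/val_inj => /=; apply/le_anti/andP; split.
  apply: ge_sup; first by exists (F (r t0))%:num, t0.
  move=> _ [t _ <-].
  by apply: ub_le_sup; [exists 1%R => _ [s _ <-] | exists (r t)].
rewrite leNgt; apply/negP => /rat_in_itvoo[q]; rewrite in_itv /= => /andP[qr].
move=> /sup_gt[|_ [u _ <-] Fu]; first by exists (F (r t0))%:num, (r t0).
have [t Ft] := appr q (ex_intro _ u Fu).
move: qr; rewrite ltNge => /negP; apply; apply/ltW/(lt_le_trans Ft).
by apply: ub_le_sup; [exists 1%R => _ [s _ <-] | exists t].
Qed.

End ExtremaOnSubfamily.

(** * Functions on legal domains and valuations *)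

Lemma legal_inhabited (M : legal) : inhabited M.
Proof. by case: M => [|n]; constructor; [exists 1%N | exact: ord0]. Qed.

Section Valuations.
Variables (R : realType) (L : logic R) (tau : vocabulary).
Implicit Types phi : formula L tau.

Lemma mem_fvars phi x : (x \in fvars phi) = (x \in free_occ phi).
Proof. by rewrite mem_sort mem_undup. Qed.

Lemma fv_inj phi : injective (@fv R L tau phi).
Proof.
move=> i j /eqP; rewrite /fv !(tnth_nth 0%N) nth_uniq //=.
  by move=> /eqP/val_inj.
by rewrite sort_uniq undup_uniq.
Qed.

Lemma truth_ext (A : model R tau) phi (v w : nat -> A) :
  (forall x, x \in free_occ phi -> v x = w x) -> truth phi v = truth phi w.
Proof.
elim: phi v w => [P x|x y|c psi IH|y psi IH|y psi IH] v w vw /=.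
- congr interp; apply/funext => i; apply: vw.
  by apply/mapP; exists i => //; rewrite mem_enum.
- by rewrite !vw //= !inE eqxx ?orbT.
- congr conn_fun; apply/funext => i; apply: IH => x xi; apply: vw.
  by apply/flatten_mapP; exists i => //; rewrite mem_enum.
- congr inf01; apply/funext => e; apply: IH => x xi; rewrite /upd.
  by case: eqP => // /eqP xy; apply: vw; rewrite /= mem_filter xy.
- congr sup01; apply/funext => e; apply: IH => x xi; rewrite /upd.
  by case: eqP => // /eqP xy; apply: vw; rewrite /= mem_filter xy.
Qed.

Lemma truth_sentence (A : model R tau) phi (v w : nat -> A) :
  sentence phi -> truth phi v = truth phi w.
Proof. by move=> s; apply: truth_ext => x; rewrite -mem_fvars s. Qed.

(** The free variables are listed without repetition, hence arguments for a
    formula can be prescribed independently of one another. *)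
Lemma valuation_of_tuple phi (T : Type) (v0 : nat -> T)
    (u : 'I_(nfv phi) -> T) : exists v, (fun l => v (fv l)) = u.
Proof.
exists (fun x => if [pick l | fv (phi := phi) l == x] is Some l then u l else v0 x).
apply/funext => l; case: pickP => [l' /eqP/fv_inj -> //|/(_ l)].
by rewrite eqxx.
Qed.

Lemma restrict_inj n (f g : X R n) :
  (forall (M : legal) (u : 'I_n -> M), Defs.restrict f u = Defs.restrict g u) -> f = g.
Proof.
case: n f g => [|n] f g fg /=; first exact: (fg (LegalFin 0) (fun=> ord0)).
by apply/functional_extensionality_dep => M; apply/funext => u; apply: fg.
Qed.

(** The type of [at_ f] does not mention the formula, which makes functions of
    different formulas comparable without casts. *)
Lemma at_inj phi (f g : X R (nfv phi)) :
  (forall (M : legal) (v : nat -> M), at_ f v = at_ g v) -> f = g.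
Proof.
move=> fg; apply: restrict_inj => M u; have [m] := legal_inhabited M.
by have [v <-] := valuation_of_tuple (fun=> m) u; apply: fg.
Qed.

(** The function of a sentence is a single number, so one legal domain already
    determines it. *)
Lemma at_sentence_inj phi (f g : X R (nfv phi)) (M : legal) (v : nat -> M) :
  sentence phi -> at_ f v = at_ g v -> f = g.
Proof.
move=> phi0; rewrite /at_; move: (fun l => _); move: f g.
by have -> : nfv phi = 0%N by rewrite /nfv phi0.
Qed.

Lemma at_Xconst phi a (M : legal) (v : nat -> M) :
  at_ (Xconst (nfv phi) a) v = a.
Proof. by rewrite /at_; move: (fun l => _); case: (nfv phi). Qed.

Lemma restrict_surj n (M : legal) (F : ('I_n -> M) -> {i01 R}) :
  exists f : X R n, forall u, Defs.restrict f u = F u.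
Proof.
case: n F => [|n] F.
  have [m] := legal_inhabited M; exists (F (fun=> m)) => u /=.
  by congr F; apply/funext => -[].
(* Away from M any value will do *)
exists (dfwith (I := {classic legal}) (T := fun N : legal => ('I_n.+1 -> N) -> {i01 R})
          (fun _ _ => 0%:i01) (M : {classic legal}) F) => u /=.
by rewrite dfwithin.
Qed.

Definition legal_model (M : legal)
    (I : forall P : pred_sym tau, ('I_(pred_ar P) -> M) -> {i01 R}) :
  model R tau := Model (legal_inhabited M) I.

Lemma at_surj phi (M : legal)
    (I : forall P : pred_sym tau, ('I_(pred_ar P) -> M) -> {i01 R}) :
  exists f : X R (nfv phi),
    forall v : nat -> M, at_ f v = truth (A := legal_model I) phi v.
Proof.
have [m] := legal_inhabited M.
have [w wE] := choice (valuation_of_tuple (phi := phi) (fun=> m)).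
have [f fE] := restrict_surj
  (fun u : 'I_(nfv phi) -> M => truth (A := legal_model I) phi (w u)).
exists f => v; rewrite /at_ fE; apply: truth_ext => x.
rewrite -mem_fvars => /(nthP 0%N)[i il <-] /=.
have := congr1 (@^~ (Ordinal il)) (wE (fun l => v (fv l))).
by rewrite /fv (tnth_nth 0%N).
Qed.

End Valuations.

(** * Families of formulas closed under subformulas *)

Section Families.
Variables (R : realType) (L : logic R) (tau : vocabulary).
Implicit Types phi : formula L tau.

Definition subformula_closed (C : set (formula L tau)) :=
  [/\ forall c psi, C (Conn c psi) -> forall t, C (psi t),
      forall y psi, C (Forall y psi) -> C psi &
      forall y psi, C (Exists y psi) -> C psi].

Lemma subformula_closed_bigcup J (C : J -> set (formula L tau)) :
  (forall j, subformula_closed (C j)) -> subformula_closed (\bigcup_j C j).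
Proof.
move=> Ccl; split=> [c psi [j _ Cj] t|y psi [j _ Cj]|y psi [j _ Cj]].
all: have [c1 c2 c3] := Ccl j; exists j => //.
- exact: c1 Cj t.
- exact: c2 Cj.
- exact: c3 Cj.
Qed.

(** Closed families are indexed by finite types rather than sequences, so that
    the union needed for a connective is a sigma type. *)
Lemma subformula_family phi : exists (T : finType) (psi : T -> formula L tau),
  subformula_closed (range psi) /\ range psi phi.
Proof.
have closed_insert phi0 : (forall C, subformula_closed C ->
    (forall c psi, phi0 = Conn c psi -> forall t, C (psi t)) ->
    (forall y psi, phi0 = Forall y psi -> C psi) ->
    (forall y psi, phi0 = Exists y psi -> C psi) ->
    subformula_closed (phi0 |` C)).
  move=> C [c1 c2 c3] d1 d2 d3; split=> [c psi|y psi|y psi].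
  - by move=> [/esym e|/c1 Cp] t; right => //; apply: d1 e t.
  - by move=> [/esym e|/c2]; right => //; apply: d2 e.
  - by move=> [/esym e|/c3]; right => //; apply: d3 e.
have range_insert phi0 (T : finType) (psi : T -> formula L tau) :
    range (fun o : option T => oapp psi phi0 o) = phi0 |` range psi.
  apply/seteqP; split=> [_ [[t|] _ <-] /=|x [->|[t _ <-]]].
  - by right; exists t.
  - by left.
  - by exists None.
  - by exists (Some t).
elim: phi => [P x|x y|c phi IH|y phi [T [psi [cl Tphi]]]|y phi [T [psi [cl Tphi]]]].
- exists (option void : finType), (oapp (fun v : void => match v with end) (Atom P x)).
  rewrite range_insert; split; last by left.
  by apply: closed_insert => //; split=> [? ? []|? ? []|? ? []] [].
- exists (option void : finType), (oapp (fun v : void => match v with end) (Equal x y)).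
  rewrite range_insert; split; last by left.
  by apply: closed_insert => //; split=> [? ? []|? ? []|? ? []] [].
- pose T t := projT1 (cid (IH t)).
  pose psi t : T t -> formula L tau := projT1 (cid (projT2 (cid (IH t)))).
  have psiP t : subformula_closed (range (psi t)) /\ range (psi t) (phi t).
    exact: (projT2 (cid (projT2 (cid (IH t))))).
  exists (option {t : 'I_(conn_ar c) & T t} : finType).
  exists (oapp (fun u : {t : 'I_(conn_ar c) & T t} => psi (tag u) (tagged u)) (Conn c phi)).
  rewrite range_insert; split; last by left.
  have -> : range (fun u : {t : 'I_(conn_ar c) & T t} => psi (tag u) (tagged u)) =
      \bigcup_t range (psi t).
    apply/seteqP; split=> [_ [[t u] _ <-]|_ [t _ [u _ <-]]].
      by exists t => //; exists u.
    by exists (Tagged T u).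
  apply: closed_insert => //; first by apply: subformula_closed_bigcup => t; case: (psiP t).
  move=> c' phi' /(congr1 (fun f => if f is Conn _ p then range p else set0)) e t.
  have [t' _ <-] : range phi (phi' t) by rewrite e; exists t.
  by exists t' => //; case: (psiP t').
- exists (option T : finType), (oapp psi (Forall y phi)); rewrite range_insert; split; last by left.
  by apply: closed_insert => // _ _ [_ <-].
- exists (option T : finType), (oapp psi (Exists y phi)); rewrite range_insert; split; last by left.
  by apply: closed_insert => // _ _ [_ <-].
Qed.

(** Components may be repeated, within an MD-sentence or between two of them, and
    the rules never contract two copies; hence every component gets an index of
    its own.  The strict inequality leaves room for the projection rule, which
    must drop at least one component. *)
Lemma joint_family (J : finType) (gamma : J -> mdsent L tau) : inhabited J ->
  exists (m : nat) (psi : 'I_m.+1 -> formula L tau),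
    subformula_closed (range psi) /\
    forall j, (md_pred (gamma j) < m)%N /\
      exists2 h : 'I_(md_pred (gamma j)).+1 -> 'I_m.+1,
        injective h & psi \o h = md_comp (m := gamma j).
Proof.
move=> [j0].
pose S phi := projT1 (cid (subformula_family phi)).
pose chi phi : S phi -> formula L tau := projT1 (cid (projT2 (cid (subformula_family phi)))).
have chiP phi : subformula_closed (range (chi phi)) /\ range (chi phi) phi.
  exact: (projT2 (cid (projT2 (cid (subformula_family phi))))).
pose D := {j : J & 'I_(md_pred (gamma j)).+1}.
pose comp (d : D) := md_comp (m := gamma (tag d)) (tagged d).
pose T : finType := (D + {d : D & S (comp d)})%type.
pose psi (t : T) := match t with inl d => comp d | inr u => chi _ (tagged u) end.
have psi_cl : subformula_closed (range psi).
  have -> : range psi = \bigcup_d range (chi (comp d)).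
    apply/seteqP; split=> [_ [[d|[d u]] _ <-]|_ [d _ [u _ <-]]].
    - by exists d => //; case: (chiP (comp d)).
    - by exists d => //; exists u.
    - by exists (inr (Tagged (fun d => S (comp d)) u)).
  by apply: subformula_closed_bigcup => d; case: (chiP (comp d)).
have Tgt j : (md_pred (gamma j) < #|T|.-1)%N.
  (* An index among the subformulas is missed by the components *)
  have [_ [s _ _]] := chiP (comp (Tagged _ (ord0 : 'I_(md_pred (gamma j)).+1))).
  have inj : injective (fun o : option 'I_(md_pred (gamma j)).+1 =>
      if o is Some i then inl (Tagged _ i) else inr (Tagged (fun d => S (comp d)) s) : T).
    by move=> [i|] [i'|] //= [/eqP]; rewrite eq_Tagged => /eqP/= ->.
  by have := leq_card _ inj; rewrite card_option card_ord; case: #|T|.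
have cT : #|T|.-1.+1 = #|T| by move: (Tgt j0); case: #|T|.
exists #|T|.-1, (fun i => psi (enum_val (cast_ord cT i))); split.
  suff -> : range (fun i => psi (enum_val (cast_ord cT i))) = range psi by [].
  apply/seteqP; split=> [_ [i _ <-]|_ [t _ <-]]; first by eexists.
  by exists (cast_ord (esym cT) (enum_rank t)) => //; rewrite cast_ordKV enum_rankK.
move=> j; split=> //.
exists (fun i => cast_ord (esym cT) (enum_rank (inl (Tagged _ i) : T))).
  move=> i i' /cast_ord_inj/enum_rank_inj[/eqP].
  by rewrite eq_Tagged => /eqP.
by apply/funext => i /=; rewrite cast_ordKV enum_rankK.
Qed.

End Families.

(** * Skolem hulls and the downward Loewenheim-Skolem theorem *)

(** Closed terms over the operations, coded by trees, are countable; the sequence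
    e lists their values. *)
Lemma countable_closure (K : countType) (A : Type) (a0 : A)
    (W : K -> seq A -> A) :
  exists e : nat -> A, forall k l, exists j, e j = W k [seq e i | i <- l].
Proof.
pose eval := fix eval (t : GenTree.tree nat) : A :=
  match t with
  | GenTree.Leaf _ => a0
  | GenTree.Node n ts => if unpickle n is Some k then W k (map eval ts) else a0
  end.
pose tree_of i : GenTree.tree nat := odflt (GenTree.Leaf 0%N) (unpickle i).
exists (fun i => eval (tree_of i)) => k l.
exists (pickle (GenTree.Node (pickle k) (map tree_of l))).
by rewrite /tree_of pickleK /= pickleK -map_comp.
Qed.

(** The values of e are counted without repetition, since equality must be
    identity on the legal domain. *)
Lemma legal_enumeration (A : Type) (e : nat -> A) :
  exists (M : legal) (r : M -> A), injective r /\ range r = range e.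
Proof.
have [fin|inf] := pselect (finite_set (range e)).
  have /finite_seqP[s es] : finite_set (range e : set {classic A}) by [].
  have es_in x : (x \in undup s) <-> range e x by rewrite mem_undup es.
  have szs : size (undup s) = (size (undup s)).-1.+1.
    have /es_in : range e (e 0%N) by exists 0%N.
    by case: (undup s).
  have lt_size (i : 'I_(size (undup s)).-1.+1) : (i < size (undup s))%N.
    exact: leq_trans (ltn_ord i) (eq_leq (esym szs)).
  exists (LegalFin (size (undup s)).-1).
  exists (fun i : 'I_(size (undup s)).-1.+1 => nth (e 0%N : {classic A}) (undup s) i).
  split=> [i j /(introT (@eqP {classic A} _ _))|].
    by rewrite nth_uniq ?undup_uniq ?lt_size // => /eqP/val_inj.
  apply/seteqP; split=> [_ [i _ <-]|x /es_in/(nthP (e 0%N : {classic A}))[i il <-]].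
    by apply/es_in; rewrite mem_nth // lt_size.
  by rewrite szs in il; exists (Ordinal il).
have ctb : countable (range e) by exact: card_image_le.
have /card_set_bijP[f [_ finj fsurj]] := eq_card_nat ctb inf.
have [g gE] : {g : nat -> A & forall n, range e (g n) /\ f (g n) = n}.
  apply: (choice (P := fun n a => range e a /\ f a = n)) => n.
  by have [a ea <-] := fsurj n I; exists a.
exists LegalInf, (fun n : {n : nat | (0 < n)%N} => g (sval n).-1); split.
  move=> [[|m] //= m0] [[|n] //= n0] /(congr1 f).
  by rewrite !(gE _).2 => mn; subst n; congr exist; exact: bool_irrelevance.
apply/seteqP; split=> [_ [n _ <-]|a ea]; first exact: (gE _).1.
exists (exist _ (f a).+1 isT) => //=.
by apply: finj; rewrite ?inE ?(gE _).2 //; exact: (gE _).1.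
Qed.

Section LowenheimSkolem.
Variables (R : realType) (L : logic R) (tau : vocabulary).

(** The legal domain is the Skolem hull of a point.  For each quantified component
    and each rational threshold q, a witness is an element that brings the scope
    below q (for infima) or above q (for suprema), if there is one.  An assignment
    enters a witness only through a finite prefix, which keeps the hull
    countable. *)
Lemma lowenheim_skolem (m : nat) (psi : 'I_m -> formula L tau)
    (A : model R tau) : subformula_closed (range psi) ->
  exists (M : legal) (r : M -> A)
      (I : forall P : pred_sym tau, ('I_(pred_ar P) -> M) -> {i01 R}),
    forall i (v : nat -> M),
      truth (A := legal_model I) (psi i) v = truth (psi i) (r \o v).
Proof.
move=> [clC clF clE]; have [a0] := carrier_nonempty A.
pose scope i (v : nat -> A) (a : A) : R :=
  match psi i with
  | Forall y phi | Exists y phi => (truth phi (upd v y a))%:num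
  | _ => 0
  end.
pose witness (k : 'I_m * rat * bool) (l : seq A) : A :=
  let: (i, q, b) := k in
  let F := scope i (nth a0 l) in
  xget (a0 : {classic A}) (if b then [set a | F a < ratr q] else [set a | ratr q < F a]).
have [e eW] := countable_closure a0 witness.
have [M [r [r_inj r_e]]] := legal_enumeration e.
have [z] := legal_inhabited M.
have hull k l : exists t, r t = witness k [seq r (u : M) | u <- l].
  have [g gE] : {g : M -> nat & forall u, e (g u) = r u}.
    apply: (choice (P := fun u i => e i = r u)) => u.
    have [j _ ej] : range e (r u) by rewrite -r_e; exists u.
    by exists j.
  have [j ej] := eW k (map g l).
  have [t _ rt] : range r (e j) by rewrite r_e; exists j.
  by exists t; rewrite rt ej -map_comp; congr (witness _ _); apply: eq_map.
(* A formula reads finitely many variables, so a long enough prefix of the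
   assignment can replace it *)
have cutoff (phi : formula L tau) (v : nat -> M) : exists l : seq M,
    forall y a, truth phi (upd (nth a0 (map r l)) y a) = truth phi (upd (r \o v) y a).
  exists (mkseq v (\max_(x <- free_occ phi) x).+1) => y a.
  apply: truth_ext => x xphi; rewrite /upd; case: eqP => // _.
  have xl : (x < (\max_(x <- free_occ phi) x).+1)%N by rewrite ltnS leq_bigmax_seq.
  by rewrite (nth_map z) ?size_mkseq // nth_mkseq.
exists M, r, (fun P u => interp (r \o u)).
suff truth_r phi : range psi phi -> forall v : nat -> M,
    truth (A := legal_model (fun P u => interp (r \o u))) phi v = truth phi (r \o v).
  by move=> i; apply: truth_r; exists i.
have updr v y t : r \o upd v y t = upd (r \o v) y (r t).
  by apply/funext => x; rewrite /upd /=; case: eqP.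
elim: phi => [P x|x y|c phi IH|y phi IH|y phi IH] psi_phi v //=.
- rewrite /eq01; congr (if _ then _ else _); apply: asbool_equiv_eq.
  by split=> [->|/r_inj].
- congr conn_fun; apply/funext => t; apply: IH; exact: clC psi_phi t.
- under [X in inf01 X]eq_fun do rewrite (IH (clF _ _ psi_phi)) updr.
  apply: (@inf01_subfamily _ _ _ r (fun a => truth phi (upd (r \o v) y a))).
    by constructor.
  move=> q [a Fa]; have [i _ psii] := psi_phi; have [l lE] := cutoff phi v.
  have [t rt] := hull (i, q, true) l; exists t; rewrite rt /witness /scope psii.
  set P := [set b | _]; rewrite -lE.
  by apply: (xgetPex (a0 : {classic A}) (P := P)); exists a; rewrite /P /= lE.
- under [X in sup01 X]eq_fun do rewrite (IH (clE _ _ psi_phi)) updr.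
  apply: (@sup01_subfamily _ _ _ r (fun a => truth phi (upd (r \o v) y a))).
    by constructor.
  move=> q [a Fa]; have [i _ psii] := psi_phi; have [l lE] := cutoff phi v.
  have [t rt] := hull (i, q, false) l; exists t; rewrite rt /witness /scope psii.
  set P := [set b | _]; rewrite -lE.
  by apply: (xgetPex (a0 : {classic A}) (P := P)); exists a; rewrite /P /= lE.
Qed.

End LowenheimSkolem.

(** * Derivations *)

Section Derivations.
Variables (R : realType) (L : logic R) (tau : vocabulary).
Implicit Types (Gamma P : set (mdsent L tau)) (eta : mdsent L tau).

Lemma infer_sub P P' eta : P `<=` P' -> infer P eta -> infer P' eta.
Proof.
move=> PP'; case=> [k phi|k phi S s|k m phi S|k phi S1 S2|k r phi S|k phi S S'|k phi S].
- exact: Axiom1.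
- by move=> /PP'; exact: Rule2.
- by move=> /PP'; exact: Rule3.
- by move=> /PP' ? /PP'; exact: Rule4.
- by move=> ? /PP'; exact: Rule5.
- by move=> ? /PP'; exact: Rule6.
- by move=> /PP'; exact: Rule7.
Qed.

(** A rule has at most two premises, so two derivations placed one after the
    other are enough to apply it. *)
Lemma infer_two_premises P eta : infer P eta -> infer set0 eta \/
  exists a b, [/\ P a, P b & infer [set a; b] eta].
Proof.
case=> [k phi|k phi S s|k m phi S|k phi S1 S2|k r phi S|k phi S S'|k phi S].
- by left; apply: Axiom1.
- move=> p; right; exists (MD S), (MD S); split=> //.
  by apply: Rule2; left.
- move=> p; right; exists (MD S), (MD S); split=> //.
  by apply: Rule3; left.
- move=> p1 p2; right; exists (MD S1), (MD S2); split=> //.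
  by apply: Rule4; [left|right].
- move=> r0 p; right; exists (@MD _ _ _ (k + r) phi S), (@MD _ _ _ (k + r) phi S); split=> //.
  by apply: Rule5 => //; left.
- move=> SS p; right; exists (MD S), (MD S); split=> //.
  by apply: Rule6 SS _; left.
- move=> p; right; exists (MD S), (MD S); split=> //.
  by apply: Rule7; left.
Qed.

Lemma proves_ind Gamma P : Gamma `<=` P -> (forall eta, infer P eta -> P eta) ->
  proves Gamma `<=` P.
Proof.
move=> GP iP eta [n [d [<- dP]]]; suff: forall i, (i <= n)%N -> P (d i) by apply.
elim/ltn_ind => i IH le_in; case: (dP i le_in) => [/GP//|inf].
apply: iP; apply: infer_sub inf => _ [j ji <-].
exact: IH ji (leq_trans (ltnW ji) le_in).
Qed.

Lemma proves_hyp Gamma : Gamma `<=` proves Gamma.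
Proof. by move=> eta Geta; exists 0%N, (fun=> eta); split=> // i _; left. Qed.

Lemma proves_infer Gamma eta : infer (proves Gamma) eta -> proves Gamma eta.
Proof.
move=> /infer_two_premises[inf0|[_ [_ [[n [d [<- dP]]] [m [e [<- eP]]] inf]]]].
  by exists 0%N, (fun=> eta); split=> // i _; right; apply: infer_sub inf0.
pose f i := if (i <= n)%N then d i else
  if (i <= n + m.+1)%N then e (i - n.+1)%N else eta.
have fd i : (i <= n)%N -> f i = d i by rewrite /f => ->.
have fe i : (i <= m)%N -> f (n.+1 + i)%N = e i.
  by move=> le_im; rewrite /f leqNgt leq_addr /= addSnnS leq_add2l ltnS le_im -addSnnS addKn.
have ft : f (n + m.+1).+1 = eta.
  rewrite /f ltnn; case: leqP => // le_n.
  by have := leq_trans le_n (leq_addr m.+1 n); rewrite ltnn.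
exists (n + m.+1).+1, f; split=> // i; rewrite leq_eqVlt => /orP[/eqP->|lt_i].
  rewrite ft; right; apply: infer_sub inf => _ [->|->].
    by exists n; [rewrite /= ltnS leq_addr|rewrite fd].
  by exists (n.+1 + m)%N; [rewrite /= addSnnS|rewrite fe].
have [le_in|lt_ni] := leqP i n.
  rewrite fd //; case: (dP i le_in) => [|inf']; [by left|right].
  apply: infer_sub inf' => _ [j /= ji <-]; exists j => //.
  by rewrite fd // (leq_trans (ltnW ji)).
have le_im : (i - n.+1 <= m)%N by rewrite leq_subLR addSnnS.
rewrite -(subnKC lt_ni) fe //.
case: (eP _ le_im) => [|inf']; [by left|right].
apply: infer_sub inf' => _ [j /= ji <-]; exists (n.+1 + j)%N; last first.
  by rewrite fe // (leq_trans (ltnW ji)).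
by rewrite /= ltn_add2l.
Qed.

End Derivations.

(** * Soundness on a legal domain *)

Section Soundness.
Variables (R : realType) (L : logic R) (tau : vocabulary).

Lemma at_cast (phi phi' : formula L tau) (x : X R (nfv phi)) : phi = phi' ->
  exists y : X R (nfv phi'), forall (M : legal) (v : nat -> M), at_ y v = at_ x v.
Proof. by move=> <-; exists x. Qed.

Variables (M : legal)
  (I : forall P : pred_sym tau, ('I_(pred_ar P) -> M) -> {i01 R}).

(** Only the values on M are constrained: this is what makes the invariant stable
    under the rules, whose sets also look at the other legal domains. *)
Definition realizes k (phi : 'I_k -> formula L tau) (f : Xprod phi) :=
  forall i (v : nat -> M), at_ (f i) v = truth (A := legal_model I) (phi i) v.

Definition accepts (eta : mdsent L tau) : Prop :=
  @realizes _ (md_comp (m := eta)) `<=` md_set (m := eta).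

Lemma realizes_sentential k (phi : 'I_k -> formula L tau) (f : Xprod phi)
    (v : nat -> M) : (forall i, sentence (phi i)) -> realizes f ->
  f = fun i => Xconst _ (truth (A := legal_model I) (phi i) v).
Proof.
move=> sent fr; apply/functional_extensionality_dep => i.
by apply: (at_sentence_inj (v := v) (sent i)); rewrite at_Xconst fr.
Qed.

Lemma accepts_sentential eta : md_sentential eta ->
  accepts eta <-> satisfies (legal_model I) eta.
Proof.
move=> sent; have [m] := legal_inhabited M; split=> [acc v|sat f fr].
  apply: acc => i w; rewrite at_Xconst; exact: truth_sentence.
by rewrite (realizes_sentential (fun=> m) sent fr); exact: sat.
Qed.

(** The model itself is the witness of goodness. *)
Lemma realizes_good k (phi : 'I_k -> formula L tau) (f : Xprod phi) :
  realizes f -> good f.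
Proof.
move=> fr; exists M, I; split.
- by move=> i P x phii v; rewrite fr phii.
- by move=> i x y phii v; rewrite fr phii.
- move=> i c idx phii v; rewrite fr phii /=; congr conn_fun.
  by apply/funext => t; rewrite fr.
- move=> i j y phii v; rewrite fr phii /=; congr inf01.
  by apply/funext => e; rewrite fr.
- move=> i j y phii v; rewrite fr phii /=; congr sup01.
  by apply/funext => e; rewrite fr.
Qed.

Lemma infer_accepts eta : infer accepts eta -> accepts eta.
Proof.
case=> [k phi|k phi S s|k m phi S|k phi S1 S2|k r phi S|k phi S S'|k phi S] //.
- (* Permutation: undo s on g, casting along phi (s (s^-1 j)) = phi j *)
  move=> acc g gr /=.
  have fE j : exists x : X R (nfv (phi j)),
      forall (N : legal) (v : nat -> N), at_ x v = at_ (g ((s^-1)%g j)) v.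
    by apply: at_cast; rewrite /= permKV.
  pose f j := projT1 (cid (fE j)).
  have fgE j : forall (N : legal) (v : nat -> N), at_ (f j) v = at_ (g ((s^-1)%g j)) v.
    exact: (projT2 (cid (fE j))).
  exists f; last first.
    apply/functional_extensionality_dep => i; apply: at_inj => N v.
    by rewrite fgE permK.
  by apply: acc => j v; rewrite fgE gr /= permKV.
- by move=> acc f fr; apply: acc => i v; exact: fr.
- by move=> acc1 acc2 f fr; split; [exact: acc1|exact: acc2].
- (* Projection: complete g by truth functions *)
  move=> _ acc g gr /=.
  have fE j : exists x : X R (nfv (phi j)),
      (forall v : nat -> M, at_ x v = truth (A := legal_model I) (phi j) v) /\
      (forall i, lshift r i = j ->
         forall (N : legal) (v : nat -> N), at_ x v = at_ (g i) v).
    case: (split_ordP j) => i ->.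
      by exists (g i); split=> [v|i' /lshift_inj->//]; rewrite gr.
    have [x xE] := at_surj (phi (rshift k.+1 i)) I; exists x; split=> // i' /eqP.
    by rewrite eq_lrshift.
  exists (fun j => projT1 (cid (fE j))).
    by apply: acc => j; have [] := projT2 (cid (fE j)).
  apply/functional_extensionality_dep => i; apply: at_inj => N v.
  by have [_ /(_ i erefl)] := projT2 (cid (fE (lshift r i))).
- by move=> SS' acc f fr; apply: SS'; exact: acc.
- by move=> acc f fr; split; [exact: acc|exact: realizes_good].
Qed.

End Soundness.

(** * Completeness *)

(** The permutation lists the values of h first, then the remaining indices. *)
Lemma perm_extending k r (h : 'I_k.+1 -> 'I_(k.+1 + r)) : injective h ->
  exists s : {perm 'I_(k.+1 + r)}, forall i, s (lshift r i) = h i.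
Proof.
move=> h_inj; pose l := codom h ++ enum [predC codom h].
have sz_l : size l = (k.+1 + r)%N.
  rewrite size_cat size_codom -cardE; apply: (@etrans _ _ #|'I_(k.+1 + r)|).
    by rewrite -(cardC (mem (codom h))) card_codom.
  by rewrite card_ord.
have uniq_l : uniq l.
  rewrite cat_uniq enum_uniq andbT; apply/andP; split; first exact/injectiveP.
  by apply/hasPn => x; rewrite mem_enum.
have nth_inj : injective (fun i : 'I_(k.+1 + r) => nth (h ord0) l i).
  by move=> i j /eqP; rewrite nth_uniq ?sz_l ?ltn_ord // => /eqP/val_inj.
exists (perm nth_inj) => i; rewrite permE /= nth_cat size_codom card_ord ltn_ord.
by rewrite codomE (nth_map ord0) ?size_enum_ord // nth_ord_enum.
Qed.

Section Completeness.
Variables (R : realType) (L : logic R) (tau : vocabulary).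
Variable Gamma : set (mdsent L tau).

(** Sets of profiles stand for sets of tuples in derivations: their type depends
    on the number of components alone, so a family of formulas can be replaced by
    an equal one without transport. *)
Definition profile := forall M : legal, (nat -> M) -> {i01 R}.

Definition profiles k (phi : 'I_k -> formula L tau) (f : Xprod phi) :
  'I_k -> profile := fun i M v => at_ (f i) v.

Lemma profiles_inj k (phi : 'I_k -> formula L tau) : injective (@profiles k phi).
Proof.
move=> f g fg; apply/functional_extensionality_dep => i; apply: at_inj => M v.
exact: (congr1 (fun p : 'I_k -> profile => p i M v) fg).
Qed.

Definition derives k (phi : 'I_k.+1 -> formula L tau)
    (Q : set ('I_k.+1 -> profile)) :=
  proves Gamma (MD (md_comp := phi) (@profiles _ phi @^-1` Q)).

(** Passing to profiles loses nothing. *)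
Lemma derivesP (eta : mdsent L tau) :
  proves Gamma eta <->
  derives (md_comp (m := eta)) (@profiles _ _ @` md_set (m := eta)).
Proof.
case: eta => k phi S; rewrite /derives /=.
suff -> : @profiles _ phi @^-1` (@profiles _ phi @` S) = S by [].
by apply/seteqP; split=> [f [g Sg /profiles_inj <-] //|f Sf]; exists f.
Qed.

Lemma derives_sub k (phi : 'I_k.+1 -> formula L tau) Q Q' :
  (forall f, Q (@profiles _ phi f) -> Q' (@profiles _ phi f)) ->
  derives phi Q -> derives phi Q'.
Proof. by move=> QQ' ?; apply/proves_infer/Rule6; [exact: QQ'|]. Qed.

Lemma derivesI k (phi : 'I_k.+1 -> formula L tau) Q Q' :
  derives phi Q -> derives phi Q' -> derives phi (Q `&` Q').
Proof. by move=> dQ dQ'; apply/proves_infer; exact: Rule4 dQ dQ'. Qed.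

Lemma derives_perm k (phi : 'I_k.+1 -> formula L tau) (s : {perm 'I_k.+1})
    (Q : set ('I_k.+1 -> profile)) :
  derives phi [set p : 'I_k.+1 -> profile | Q (p \o s)] -> derives (phi \o s) Q.
Proof.
move=> dQ; apply/proves_infer/Rule6; last exact/proves_infer/(Rule2 s)/dQ.
by move=> _ [f Qf <-].
Qed.

(** The rules only add components at the end; a permutation then moves the old
    ones to the positions given by h. *)
Lemma derives_extend k m (phi : 'I_k.+1 -> formula L tau)
    (psi : 'I_m.+1 -> formula L tau) (h : 'I_k.+1 -> 'I_m.+1)
    (Q : set ('I_k.+1 -> profile)) :
  (k <= m)%N -> injective h -> psi \o h = phi -> derives phi Q ->
  derives psi [set p : 'I_m.+1 -> profile | Q (p \o h)].
Proof.
move=> /subnKC; move: (m - k)%N => r def_m; subst m => h_inj <- dQ.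
have [s sE] := perm_extending (r := r) h_inj.
pose chi : 'I_(k.+1 + r) -> formula L tau := psi \o s.
have -> : psi = chi \o (s^-1)%g by apply/funext => i; rewrite /chi /= permKV.
apply: (@derives_perm (k + r)).
have chiE : psi \o h = fun i => chi (lshift r i).
  by apply/funext => i; rewrite /chi /= sE.
rewrite chiE in dQ.
apply/proves_infer/Rule6; last exact/proves_infer/(Rule3 (phi := chi) (m := r))/dQ.
move=> f /= Qf; congr Q: Qf; apply/funext => i.
by rewrite /profiles /= -sE permK.
Qed.

Lemma derives_project k m (phi : 'I_k.+1 -> formula L tau)
    (psi : 'I_m.+1 -> formula L tau) (h : 'I_k.+1 -> 'I_m.+1)
    (Q : set ('I_k.+1 -> profile)) :
  (k < m)%N -> injective h -> psi \o h = phi ->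
  derives psi [set p : 'I_m.+1 -> profile | Q (p \o h)] -> derives phi Q.
Proof.
move=> lt_km; have := subnKC (ltnW lt_km); move: lt_km; rewrite -subn_gt0.
move: (m - k)%N => r r0 def_m; subst m => h_inj <- dQ.
have [s sE] := perm_extending (r := r) h_inj.
have -> : psi \o h = fun i => (psi \o s) (lshift r i).
  by apply/funext => i; rewrite /= sE.
apply/proves_infer/Rule6; last first.
  apply/proves_infer/(Rule5 (phi := (psi \o s : 'I_(k.+1 + r) -> _)) r0).
  apply: (@derives_perm (k + r) psi s
    [set p : 'I_(k + r).+1 -> profile | Q (fun i => p (lshift r i))]).
  apply: derives_sub dQ => f /= Qf; congr Q: Qf.
    by apply/funext => i; rewrite /= sE.
by move=> _ [f Qf <-].
Qed.

(** Goodness fixes the atoms and follows the truth clauses down to immediate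
    subformulas; closure makes all of these available, so induction on formulas
    identifies each component with its truth function. *)
Lemma good_truth k (psi : 'I_k -> formula L tau) (f : Xprod psi) :
  subformula_closed (range psi) -> good f ->
  exists (M : legal) (I : forall P : pred_sym tau, ('I_(pred_ar P) -> M) -> {i01 R}),
    realizes I f.
Proof.
move=> [clC clF clE] [M [I [atomE eqE connE forallE existsE]]].
exists M, I; suff at_f phi i (v : nat -> M) : psi i = phi ->
    at_ (f i) v = truth (A := legal_model I) phi v by move=> i v; exact: at_f.
elim: phi i v => [P x|x y|c phi IH|y phi IH|y phi IH] i v psii /=.
- by rewrite (atomE _ _ _ psii).
- by rewrite (eqE _ _ _ psii).
- have [idx idxE] : {idx : 'I_(conn_ar c) -> 'I_k & forall t, psi (idx t) = phi t}.
    apply: (choice (P := fun t j => psi j = phi t)) => t.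
    have [|j _ <-] := clC c phi _ t; first by exists i.
    by exists j.
  rewrite (connE i c idx); last by rewrite psii; congr Conn; apply/funext.
  by congr conn_fun; apply/funext => t; exact: IH.
- have [|j _ psij] := clF y phi; first by exists i.
  rewrite (forallE i j y) ?psii ?psij //; congr inf01; apply/funext => e.
  exact: IH.
- have [|j _ psij] := clE y phi; first by exists i.
  rewrite (existsE i j y) ?psii ?psij //; congr sup01; apply/funext => e.
  exact: IH.
Qed.

End Completeness.

(** * Finite sets of sentential hypotheses *)

Section FiniteTheories.
Variables (R : realType) (L : logic R) (tau : vocabulary).
Variables (Gamma : set (mdsent L tau)) (theta : mdsent L tau).
Hypothesis Gamma_fin : finite_set Gamma.
Hypothesis Gamma_sent : forall gamma, Gamma gamma -> md_sentential gamma.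
Hypothesis theta_sent : md_sentential theta.

Lemma hypotheses_family : exists (J : finType) (eta : J -> mdsent L tau),
  (forall gamma, Gamma gamma -> exists j, eta j = gamma) /\ exists j, eta j = theta.
Proof.
have /finite_seqP[s GammaE] : finite_set (Gamma : set {classic mdsent L tau}) by [].
exists 'I_(size s).+1, (fun j : 'I_(size s).+1 => nth (theta : {classic mdsent L tau}) s j).
split; last by exists ord_max; rewrite nth_default.
move=> gamma; rewrite GammaE => /= /(nthP (theta : {classic _}))[i i_lt <-].
by exists (Ordinal (ltnW i_lt : i < (size s).+1)%N).
Qed.

Lemma satisfies_transfer (A B : model R tau) (eta : mdsent L tau) :
  md_sentential eta ->
  (forall i, exists v w, truth (A := A) (md_comp (m := eta) i) v =
                         truth (A := B) (md_comp (m := eta) i) w) ->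
  satisfies A eta <-> satisfies B eta.
Proof.
move=> sent AB; have [a] := carrier_nonempty A; have [b] := carrier_nonempty B.
have AB' (v : nat -> A) (w : nat -> B) :
    (fun i => Xconst (nfv (md_comp (m := eta) i)) (truth (md_comp i) v)) =
    (fun i => Xconst (nfv (md_comp i)) (truth (md_comp i) w)).
  apply/functional_extensionality_dep => i; have [v' [w' e]] := AB i; congr Xconst.
  by rewrite (truth_sentence v v' (sent i)) e; exact: truth_sentence.
by split=> sat u; [rewrite -(AB' (fun=> a))|rewrite (AB' _ (fun=> b))]; exact: sat.
Qed.

Lemma soundness : proves Gamma theta -> entails Gamma theta.
Proof.
move=> prf A satA; have [J [eta [etaG [j0 etaT]]]] := hypotheses_family.
have [m [psi [cl etaP]]] := joint_family eta (inhabits j0).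
have [M [r [I rE]]] := lowenheim_skolem A cl.
have sat j : md_sentential (eta j) -> satisfies (legal_model I) (eta j) <-> satisfies A (eta j).
  move=> sent; apply: satisfies_transfer => // i.
  have [_ [h _ hE]] := etaP j; have [z] := legal_inhabited M.
  by exists (fun=> z), (r \o fun=> z); rewrite -hE /= rE.
have := sat j0; rewrite etaT => /(_ theta_sent)[+ _]; apply.
apply/accepts_sentential => //.
apply: (proves_ind (Gamma := Gamma)) prf; last exact: infer_accepts.
move=> gamma Ggamma; have gamma_sent := Gamma_sent Ggamma.
apply/accepts_sentential => //.
have [j etaj] := etaG _ Ggamma; have := sat j; rewrite etaj.
by move=> /(_ gamma_sent)[_]; apply; exact: satA.
Qed.

Lemma completeness : entails Gamma theta -> proves Gamma theta.
Proof.
move=> ent; have [J [eta [etaG [j0 etaT]]]] := hypotheses_family.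
have [m [psi [cl etaP]]] := joint_family eta (inhabits j0).
pose h j := sval (cid2 (etaP j).2).
have h_inj j : injective (h j) by rewrite /h; case: cid2.
have psi_h j : psi \o h j = md_comp (m := eta j) by rewrite /h; case: cid2.
pose Q j : set ('I_(md_pred (eta j)).+1 -> profile R) :=
  @profiles _ _ _ _ _ @` md_set (m := eta j).
have all_hyps (l : seq J) : derives Gamma psi
    [set p : 'I_m.+1 -> profile R | forall j, j \in l -> Gamma (eta j) -> Q j (p \o h j)].
  elim: l => [|j l IH].
    by apply: proves_infer; apply: Rule6; last exact/proves_infer/Axiom1.
  have [Gj|nGj] := pselect (Gamma (eta j)); last first.
    by apply: derives_sub IH => f Qf j'; rewrite inE => /orP[/eqP->//|]; apply: Qf.
  have : derives Gamma psi [set p : 'I_m.+1 -> profile R | Q j (p \o h j)].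
    apply: (derives_extend (ltnW (etaP j).1) (h_inj j) (psi_h j)).
    exact: (derivesP Gamma (eta j)).1 (proves_hyp Gj).
  move=> /(derivesI IH); apply: derives_sub => f [Qf Qj] j'.
  by rewrite inE => /orP[/eqP->//|]; apply: Qf.
have theta_j : derives Gamma (md_comp (m := eta j0)) (Q j0).
  apply: (derives_project (etaP j0).1 (h_inj j0) (psi_h j0)).
  apply/proves_infer/Rule6; last exact/proves_infer/Rule7/(all_hyps (enum J)).
  move=> f [/= hyps /(good_truth cl)[M [I fr]]].
  have at_h j : exists2 g, realizes I g &
      @profiles _ _ _ _ (md_comp (m := eta j)) g = @profiles _ _ _ _ psi f \o h j.
    rewrite -(psi_h j); exists (fun i => f (h j i)) => //.
    by move=> i v; exact: fr.
  have [g gr <-] := at_h j0; exists g => //.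
  have: accepts I (eta j0); last exact.
  rewrite etaT; apply/accepts_sentential => //; apply: ent => gamma Ggamma.
  have [j etaj] := etaG _ Ggamma; move: Ggamma; rewrite -etaj => Gj v.
  have [g' Sg' g'E] := hyps j (mem_enum J j) Gj.
  have [g'' g''r g''E] := at_h j; move: Sg'.
  have -> : g' = g'' by apply: profiles_inj; rewrite g'E g''E.
  by rewrite (realizes_sentential v (Gamma_sent Gj) g''r).
by rewrite -etaT; exact: (derivesP Gamma (eta j0)).2 theta_j.
Qed.

End FiniteTheories.

Theorem corollary32 (R : realType) (L : logic R) (tau : vocabulary)
    (Gamma : set (mdsent L tau)) (theta : mdsent L tau) :
  finite_set Gamma ->
  (forall gamma, Gamma gamma -> md_sentential gamma) ->
  md_sentential theta ->
  proves Gamma theta <-> entails Gamma theta.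
Proof.
by move=> fin sent theta_sent; split; [exact: soundness|exact: completeness].
Qed.
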